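(* Consider, for agent $i$, the tracking error system $$e_i(k+1)=Ae_i(k)+F_iu_i(k)+\sum_{j\in N_i}E_{ij}u_j(k),\qquad y_i(k)=C_ie_i(k),$$ and let $\mathcal{B}_{N_i},\mathcal{B}_{N_{ij}},\mathcal{C}_{N_i},\mathcal{D}_{N_i},\mathcal{D}_{N_{ij}}$ and the data vectors $\bar u_{i[k-1,k-N]},\bar u_{j[k-1,k-N]},\bar y_{i[k-1,k-N]}$ be as defined in the context. If $\mathcal{C}_{N_i}$ is of full column rank, then there exists an error estimator based on the input/output data sequences $\bar u_{i[k-1,k-N]}$, $\bar u_{j[k-1,k-N]}$ ($j\in N_i$) and $\bar y_{i[k-1,k-N]}$ for the tracking error system, as follows: $$e_i(k)=T_{u_i}\bar u_{i[k-1,k-N]}+\sum_{j\in N_i}T_{u_{ij}}\bar u_{j[k-1,k-N]}+T_{y_i}\bar y_{i[k-1,k-N]},$$ where $T_{y_i}=A^N\mathcal{C}_{N_i}^+$, $T_{u_i}=\mathcal{B}_{N_i}-A^N\mathcal{C}_{N_i}^+\mathcal{D}_{N_i}$ and $T_{u_{ij}}=\mathcal{B}_{N_{ij}}-A^N\mathcal{C}_{N_i}^+\mathcal{D}_{N_{ij}}$, with $\mathcal{C}_{N_i}^+=(\mathcal{C}_{N_i}^T\mathcal{C}_{N_i})^{-1}\mathcal{C}_{N_i}^T$ the left pseudo-inverse of $\mathcal{C}_{N_i}$.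
   Context: Multi-agent system. There are $\bar N$ agents $x_i(k+1)=Ax_i(k)+B_iu_i(k)$, $x_i(k)\in\mathbb{R}^n$, $u_i(k)\in\mathbb{R}^{m_i}$, with $(A,B_i)$ reachable for all $i$, and a leader $x_0(k+1)=Ax_0(k)$. The communication graph is a fixed, simple, strongly connected weighted digraph with weights $a_{ij}\ge0$ ($a_{ij}>0$ iff there is an edge from $v_j$ to $v_i$); $N_i$ is the set of neighbors $j$ of node $i$ (those with $a_{ij}>0$); $d_i=\sum_ja_{ij}$; the gains $b_i\ge0$ link node $i$ to the leader, with $b_i>0$ for at least one $i$. The local neighborhood tracking error is $e_i(k)=\sum_{j\in N_i}a_{ij}(x_i(k)-x_j(k))+b_i(x_i(k)-x_0(k))\in\mathbb{R}^n$, and it obeys the tracking error system with $F_i=(d_i+b_i)B_i$, $E_{ij}=-a_{ij}B_j$. The output matrix is $C_i\in\mathbb{R}^{q_i\times n}$ with $(A,C_i)$ observable. Data over a horizon of length $N$ (a positive integer, $N$ being distinct from the neighbor set $N_i$), at current time $k$. The stacked column vectors are $\bar u_{i[k-1,k-N]}=(u_i(k-1),u_i(k-2),\dots,u_i(k-N))\in\mathbb{R}^{m_iN}$, $\bar u_{j[k-1,k-N]}=(u_j(k-1),u_j(k-2),\dots,u_j(k-N))\in\mathbb{R}^{m_jN}$, $\bar y_{i[k-1,k-N]}=(y_i(k-1),y_i(k-2),\dots,y_i(k-N))\in\mathbb{R}^{q_iN}$. Matrices: $\mathcal{B}_{N_i}=[F_i\ \ AF_i\ \cdots\ A^{N-2}F_i\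 \ A^{N-1}F_i]\in\mathbb{R}^{n\times m_iN}$, $\mathcal{B}_{N_{ij}}=[E_{ij}\ \ AE_{ij}\ \cdots\ A^{N-2}E_{ij}\ \ A^{N-1}E_{ij}]\in\mathbb{R}^{n\times m_jN}$, $\mathcal{C}_{N_i}\in\mathbb{R}^{q_iN\times n}$ is the vertical stack, from top to bottom, of $C_iA^{N-1},C_iA^{N-2},\dots,C_i$. $\mathcal{D}_{N_i}\in\mathbb{R}^{q_iN\times m_iN}$ is the $N\times N$ block matrix, with blocks of size $q_i\times m_i$, whose $(r,c)$ block is $C_iA^{c-r-1}F_i$ if $c>r$ and $0$ if $c\le r$ (strictly block upper triangular). $\mathcal{D}_{N_{ij}}\in\mathbb{R}^{q_iN\times m_jN}$ ($j\in N_i$) is the $N\times N$ block matrix, with blocks of size $q_i\times m_j$, whose $(r,c)$ block is $C_iA^{c-r-1}E_{ij}$ if $c>r$ and $0$ if $c\le r$. *)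

(* Defs.v *)
From HB Require Import structures.
From mathcomp Require Import all_boot all_order all_algebra.
From mathcomp Require Import reals.

Set Implicit Arguments.
Unset Strict Implicit.
Unset Printing Implicit Defensive.

Import Order.TTheory GRing.Theory Num.Theory.
Local Open Scope ring_scope.

Section LinearSystem.
Variables (R : realType) (n m q : nat).
Implicit Types (A : 'M[R]_n) (B : 'M[R]_(n, m)) (C : 'M[R]_(q, n)).

Definition lti_trajectory A B (x : nat -> 'cV[R]_n) (u : nat -> 'cV[R]_m) :=
  forall k, x k.+1 = A *m x k + B *m u k.

Definition free_trajectory A (x : nat -> 'cV[R]_n) :=
  forall k, x k.+1 = A *m x k.

Definition reachable A B :=
  forall xf : 'cV[R]_n, exists (K : nat) (x : nat -> 'cV[R]_n)
    (u : nat -> 'cV[R]_m),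
    [/\ x 0 = 0, lti_trajectory A B x u & x K = xf].

(* Equal known inputs contribute equally to two outputs, so observability only
   concerns the free response. *)
Definition observable A C :=
  forall x x' : nat -> 'cV[R]_n,
    free_trajectory A x -> free_trajectory A x' ->
    (forall k, C *m x k = C *m x' k) -> x 0 = x' 0.

End LinearSystem.

(* A weighted digraph on 'I_Nb is its weight matrix: 0 < a i j iff there is an
   edge from j to i. Multiple edges are excluded by this encoding, so
   simplicity amounts to the absence of self-loops. *)
Section Graph.
Variables (R : realType) (Nb : nat) (a : 'M[R]_Nb).

Definition edge : rel 'I_Nb := [rel j i | 0 < a i j].

Definition neighbors (i : 'I_Nb) : {set 'I_Nb} := [set j | edge j i].

Definition in_degree (i : 'I_Nb) : R := \sum_j a i j.

Definition simple_weighted_digraph :=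
  (forall i j, 0 <= a i j) /\ (forall i, a i i = 0).

Definition strongly_connected := forall i j, connect edge i j.

End Graph.

Section TrackingError.
Variables (R : realType) (Nb n : nat) (m : 'I_Nb -> nat).
Variables (A : 'M[R]_n) (B : forall i, 'M[R]_(n, m i)).
Variables (a : 'M[R]_Nb) (b : 'I_Nb -> R).

Definition local_error (x : 'I_Nb -> nat -> 'cV[R]_n) (x0 : nat -> 'cV[R]_n)
    (i : 'I_Nb) (k : nat) : 'cV[R]_n :=
  \sum_(j in neighbors a i) a i j *: (x i k - x j k) + b i *: (x i k - x0 k).

Definition Fmx (i : 'I_Nb) : 'M[R]_(n, m i) := (in_degree a i + b i) *: B i.

Definition Emx (i j : 'I_Nb) : 'M[R]_(n, m j) := - (a i j *: B j).

Definition tracking_error_system (i : 'I_Nb) (q : nat) (C : 'M[R]_(q, n))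
    (e : nat -> 'cV[R]_n) (u : forall j, nat -> 'cV[R]_(m j))
    (y : nat -> 'cV[R]_q) :=
  (forall k, e k.+1 = A *m e k + Fmx i *m u i k
                      + \sum_(j in neighbors a i) Emx i j *m u j k) /\
  (forall k, y k = C *m e k).

Lemma local_error_system (i : 'I_Nb) (q : nat) (C : 'M[R]_(q, n))
    (x : 'I_Nb -> nat -> 'cV[R]_n) (x0 : nat -> 'cV[R]_n)
    (u : forall j, nat -> 'cV[R]_(m j)) :
  simple_weighted_digraph a ->
  (forall j, lti_trajectory A (B j) (x j) (u j)) -> free_trajectory A x0 ->
  tracking_error_system i C (local_error x x0 i) u
    (fun k => C *m local_error x x0 i k).
Proof.
move=> [a_ge0 _] xP x0P; split=> // k.
have dE : in_degree a i = \sum_(j in neighbors a i) a i j.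
  rewrite /in_degree (bigID (mem (neighbors a i))) /= [X in _ + X]big1 ?addr0//.
  move=> j; rewrite inE /edge /= -leNgt => aij.
  by apply/eqP; rewrite eq_le aij a_ge0.
rewrite /local_error /Fmx /Emx dE x0P xP.
have -> : \sum_(j in neighbors a i) a i j *: (A *m x i k + B i *m u i k - x j k.+1)
  = A *m (\sum_(j in neighbors a i) a i j *: (x i k - x j k))
    + (\sum_(j in neighbors a i) a i j) *: (B i *m u i k)
    + \sum_(j in neighbors a i) - (a i j *: B j) *m u j k.
  rewrite mulmx_sumr scaler_suml -!big_split /=; apply: eq_bigr => j _.
  rewrite xP -scalemxAr mulmxBr mulNmx -scalemxAl -scalerN -!scalerDr.
  by rewrite opprD addrACA addrA.
have -> : b i *: (A *m x i k + B i *m u i k - A *m x0 k)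
  = A *m (b i *: (x i k - x0 k)) + b i *: (B i *m u i k).
  by rewrite -scalemxAr mulmxBr -scalerDr addrAC.
by rewrite mulmxDr -scalemxAl scalerDl addrAC addrACA.
Qed.

End TrackingError.

(* Blocks are laid out with \mxrow, \mxcol and \mxblock, so that a dimension
   m * N appears as \sum_(t < N) m. Block indices start from 0. *)
Section DataMatrices.
Variables (R : realType) (n : nat) (A : 'M[R]_n) (N : nat).

(* The stack (s (k - 1), ..., s (k - N)). Subtraction is truncated, so this has
   its intended meaning for N <= k only. *)
Definition data_window (p : nat) (s : nat -> 'cV[R]_p) (k : nat) :
    'cV[R]_(\sum_(t < N) p) :=
  \mxcol_(t < N) s (k - t.+1)%N.

Definition ctrb_mx (p : nat) (G : 'M[R]_(n, p)) : 'M[R]_(n, \sum_(t < N) p) :=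
  \mxrow_(t < N) (A ^+ t *m G).

Definition obsv_mx (q : nat) (C : 'M[R]_(q, n)) : 'M[R]_(\sum_(t < N) q, n) :=
  \mxcol_(t < N) (C *m A ^+ (N - t.+1)%N).

Definition toeplitz_mx (q p : nat) (C : 'M[R]_(q, n)) (G : 'M[R]_(n, p)) :
    'M[R]_(\sum_(t < N) q, \sum_(t < N) p) :=
  \mxblock_(r < N, c < N)
    (if (r < c)%N then C *m A ^+ (c - r - 1)%N *m G else 0).

End DataMatrices.

Definition left_pinv (R : realType) (p n : nat) (M : 'M[R]_(p, n)) :
  'M[R]_(n, p) := invmx (M^T *m M) *m M^T.

Section EstimatorGains.
Variables (R : realType) (n q : nat) (A : 'M[R]_n) (C : 'M[R]_(q, n)).
Variable N : nat.

Definition gain_y : 'M[R]_(n, \sum_(t < N) q) :=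
  A ^+ N *m left_pinv (obsv_mx A N C).

(* T_{u_i} and T_{u_ij} are the cases G = F_i and G = E_ij. *)
Definition gain_u (p : nat) (G : 'M[R]_(n, p)) : 'M[R]_(n, \sum_(t < N) p) :=
  ctrb_mx A N G - A ^+ N *m left_pinv (obsv_mx A N C) *m toeplitz_mx A N C G.

End EstimatorGains.

(* Main.v *)
Require Import Defs.
From HB Require Import structures.
From mathcomp Require Import all_boot all_order all_algebra.
From mathcomp Require Import reals.

Set Implicit Arguments.
Unset Strict Implicit.
Unset Printing Implicit Defensive.

Import Order.TTheory GRing.Theory Num.Theory.
Local Open Scope ring_scope.

(** Seen by agent i, the neighbors' inputs are just further inputs: the error
obeys e(k+1) = A e(k) + w(k) with the single lumped input
w = F_i u_i + \sum_j E_ij u_j. Unrolling this recursion from the start k - N of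
the window gives two affine expressions in the unknown e(k - N):
- the current error, e(k) = A^N e(k - N) + ctrb W;
- the recorded outputs, Y = obsv e(k - N) + toeplitz W,
where W and Y stack w and y over the window. Full column rank of obsv makes its
Gram matrix invertible, so its left pseudo-inverse recovers e(k - N) from Y and
W ([mul_left_pinv]); substituting in the first expression gives the estimator
for w ([lumped_estimator]). The gains for F_i and E_ij then come out by
linearity, because feeding u through G is the same as feeding w = G u through
the identity ([gain_u_lump]). *)

(** If v kills M^T M then |M v^T|^2 = v (M^T M) v^T = 0, hence M v^T = 0, and
v = 0 as the columns of M are independent. *)
Lemma gram_unitmx (R : realType) (p n : nat) (M : 'M[R]_(p, n)) :
  \rank M = n -> M^T *m M \in unitmx.
Proof.
move=> rkM; rewrite -row_free_unit; apply/inj_row_free => v vMM0.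
have MT_free : row_free M^T by rewrite /row_free mxrank_tr rkM.
have sq0 : v *m M^T *m (v *m M^T)^T = 0.
  by rewrite trmx_mul trmxK !mulmxA -(mulmxA v) vMM0 mul0mx.
have vM0 : v *m M^T = 0.
  apply/rowP => j; rewrite [RHS]mxE.
  move/matrixP/(_ 0 0): sq0; rewrite mxE [RHS]mxE => /psumr_eq0P sq0.
  apply/eqP; rewrite -sqrf_eq0 expr2.
  have := sq0 _ j isT; rewrite [_^T _ _]mxE => -> // l _.
  by rewrite [_^T _ _]mxE -expr2 sqr_ge0.
by apply/eqP; rewrite -(mulmx_free_eq0 v MT_free) vM0.
Qed.

Lemma mul_left_pinv (R : realType) (p n : nat) (M : 'M[R]_(p, n)) :
  \rank M = n -> left_pinv M *m M = 1%:M.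
Proof. by move=> rkM; rewrite /left_pinv -mulmxA mulVmx // gram_unitmx. Qed.

Section Response.
Variables (R : realType) (n : nat) (A : 'M[R]_n).

Lemma state_response (e w : nat -> 'cV[R]_n) :
  lti_trajectory A 1%:M e w -> forall k t,
  e (k + t)%N = A ^+ t *m e k + \sum_(l < t) A ^+ l *m w (k + t - l.+1)%N.
Proof.
move=> eP k; elim=> [|t IHt].
  by rewrite addn0 expr0 mul1mx big_ord0 addr0.
rewrite addnS eP mul1mx IHt big_ord_recl expr0 mul1mx subn1 /= mulmxDr.
rewrite mulmxA mulmxE -exprS -addrA [RHS]addrCA [RHS]addrC -addrA.
congr (_ + (_ + _)); rewrite mulmx_sumr; apply: eq_bigr => l _.
by rewrite mulmxA mulmxE -exprS subSS.
Qed.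

Lemma ctrb_windowE (N p : nat) (G : 'M[R]_(n, p)) (v : nat -> 'cV[R]_p) k :
  ctrb_mx A N G *m data_window N v k =
  \sum_(t < N) A ^+ t *m (G *m v (k - t.+1)%N).
Proof.
by rewrite mul_mxrow_mxcol; apply: eq_bigr => t _; rewrite mulmxA.
Qed.

Lemma toeplitz_windowE (N p q : nat) (C : 'M[R]_(q, n)) (G : 'M[R]_(n, p))
    (v : nat -> 'cV[R]_p) k :
  toeplitz_mx A N C G *m data_window N v k =
  \mxcol_(r < N) \sum_(c < N | (r < c)%N)
     C *m A ^+ (c - r - 1)%N *m (G *m v (k - c.+1)%N).
Proof.
rewrite /toeplitz_mx mxblockEv mxcol_mul; apply/eq_mxcolP => r.
rewrite mul_mxrow_mxcol.
rewrite [RHS]big_mkcond; apply: eq_bigr => c _.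
by case: ifP => _; rewrite ?mul0mx // -!mulmxA.
Qed.

Lemma state_window (e w : nat -> 'cV[R]_n) : lti_trajectory A 1%:M e w ->
  forall N k, (N <= k)%N ->
  e k = A ^+ N *m e (k - N)%N + ctrb_mx A N 1%:M *m data_window N w k.
Proof.
move=> eP N k leNk; rewrite -[in LHS](subnK leNk) (state_response eP) subnK //.
by rewrite ctrb_windowE; congr (_ + _); apply: eq_bigr => t _; rewrite mul1mx.
Qed.

(** Row r unrolls the recursion for N - r - 1 steps only, whence the strictly
upper triangular shape: y(k - r - 1) sees the inputs w(k - c - 1), c > r. *)
Lemma output_window (q : nat) (C : 'M[R]_(q, n)) (e w : nat -> 'cV[R]_n) :
  lti_trajectory A 1%:M e w -> forall N k, (N <= k)%N ->
  data_window N (fun l => C *m e l) k =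
  obsv_mx A N C *m e (k - N)%N + toeplitz_mx A N C 1%:M *m data_window N w k.
Proof.
move=> eP N k leNk; rewrite toeplitz_windowE /obsv_mx mxcol_mul -mxcolD.
apply/eq_mxcolP => r.
have kr : (k - r.+1 = k - N + (N - r.+1))%N by rewrite addnBA // subnK.
rewrite [in LHS]kr (state_response eP) -kr mulmxDr mulmxA; congr (_ + _).
rewrite mulmx_sumr -(big_mkord xpredT (fun l =>
  C *m (A ^+ l *m w (k - r.+1 - l.+1)%N))).
rewrite -(big_geq_mkord _ _ xpredT (fun c =>
  C *m A ^+ (c - r - 1)%N *m (1%:M *m w (k - c.+1)%N))).
(* The input w(k - r - l - 2) of step l is column c = l + r + 1. *)
rewrite (big_addn 0 N r.+1); apply: eq_bigr => l _.
have -> : (l + r.+1 - r - 1 = l)%N by rewrite -subnDA addn1 addnK.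
by rewrite mul1mx mulmxA -[in LHS]subnDA addnC addSn.
Qed.

End Response.

Section Estimator.
Variables (R : realType) (n q : nat) (A : 'M[R]_n) (C : 'M[R]_(q, n)) (N : nat).

Lemma lumped_estimator (e w : nat -> 'cV[R]_n) :
  \rank (obsv_mx A N C) = n -> lti_trajectory A 1%:M e w ->
  forall k, (N <= k)%N ->
  e k = gain_u A C N 1%:M *m data_window N w k
        + gain_y A C N *m data_window N (fun l => C *m e l) k.
Proof.
move=> rkO eP k leNk.
rewrite (output_window C eP leNk) /gain_u /gain_y mulmxBl mulmxDr.
rewrite -[A ^+ N *m _ *m (obsv_mx _ _ _ *m _)]mulmxA (mulmxA (left_pinv _)).
rewrite mul_left_pinv // mul1mx [in LHS](state_window eP leNk) mulmxA.
by rewrite [A ^+ N *m _ + _ in RHS]addrC addrA subrK addrC.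
Qed.

Lemma gain_u_lump (p : nat) (G : 'M[R]_(n, p)) (v : nat -> 'cV[R]_p) k :
  gain_u A C N G *m data_window N v k =
  gain_u A C N 1%:M *m data_window N (fun l => G *m v l) k.
Proof.
rewrite /gain_u !mulmxBl -!(mulmxA _ (toeplitz_mx _ _ _ _)).
rewrite !ctrb_windowE !toeplitz_windowE; congr (_ - _).
  by apply: eq_bigr => t _; rewrite mul1mx.
by congr (_ *m _); apply/eq_mxcolP => r; apply: eq_bigr => c _; rewrite mul1mx.
Qed.

End Estimator.

Theorem theorem2 (R : realType) (Nb n : nat) (m q : 'I_Nb -> nat)
    (A : 'M[R]_n) (B : forall j : 'I_Nb, 'M[R]_(n, m j))
    (C : forall j : 'I_Nb, 'M[R]_(q j, n))
    (a : 'M[R]_Nb) (b : 'I_Nb -> R)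
    (hreach : forall j : 'I_Nb, reachable A (B j))
    (hobs : forall j : 'I_Nb, observable A (C j))
    (hsimple : simple_weighted_digraph a)
    (hconn : strongly_connected a)
    (hb_ge0 : forall j : 'I_Nb, 0 <= b j)
    (hb_gt0 : exists j : 'I_Nb, 0 < b j)
    (i : 'I_Nb) (N : nat) (hN : (0 < N)%N)
    (hrank : \rank (obsv_mx A N (C i)) = n) :
  forall (e : nat -> 'cV[R]_n) (u : forall j : 'I_Nb, nat -> 'cV[R]_(m j))
    (y : nat -> 'cV[R]_(q i)),
  tracking_error_system A B a b i (C i) e u y ->
  forall k : nat, (N <= k)%N ->
  e k = gain_u A (C i) N (Fmx B a b i) *m data_window N (u i) k
        + \sum_(j in neighbors a i)
            gain_u A (C i) N (Emx B a i j) *m data_window N (u j) k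
        + gain_y A (C i) N *m data_window N y k.
Proof.
move=> e u y [eP yP] k leNk.
pose w k := Fmx B a b i *m u i k + \sum_(j in neighbors a i) Emx B a i j *m u j k.
have ewP : lti_trajectory A 1%:M e w by move=> l; rewrite eP mul1mx addrA.
rewrite [LHS](lumped_estimator hrank ewP leNk); congr (_ + _); last first.
  by congr (_ *m _); apply/eq_mxcolP => t; rewrite yP.
rewrite (gain_u_lump _ _ _ (Fmx B a b i)).
rewrite [X in _ = _ + X](eq_bigr _ (fun j _ =>
  gain_u_lump A (C i) N (Emx B a i j) (u j) k)).
rewrite -mulmx_sumr -mulmxDr; congr (_ *m _).
by rewrite /data_window -(mxcol_sum (fun j t => _ *m u j _)) -mxcolD.
Qed.
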